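(* There is no indecomposable Banach space $E$ over $\mathbb{R}$ or over $\mathbb{C}$ such that $E$ has the primary factorisation property.
   Context: For a Banach space $E$, $\mathcal{B}(E)$ denotes the Banach algebra of bounded linear operators on $E$ and $\mathrm{Id}_E$ the identity operator. The operator $\mathrm{Id}_E$ factors through $T\in\mathcal{B}(E)$ if there are $U,V\in\mathcal{B}(E)$ with $UTV=\mathrm{Id}_E$. $E$ has the primary factorisation property (PFP) if for every $T\in\mathcal{B}(E)$ the identity $\mathrm{Id}_E$ factors through $T$ or through $\mathrm{Id}_E-T$. An infinite-dimensional Banach space $E$ is indecomposable if there are no closed, infinite-dimensional subspaces $F,G$ of $E$ with $E=F\oplus G$; equivalently, for every idempotent $P\in\mathcal{B}(E)$, $\ker P$ or $P[E]$ is finite-dimensional. (Indecomposable spaces are by definition infinite-dimensional.) *)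

(* Defs.v *)
From HB Require Import structures.
From mathcomp Require Import all_boot all_order all_algebra complex.
From mathcomp Require Import boolp classical_sets functions reals topology.
From mathcomp Require Import normedtype.

Set Implicit Arguments.
Unset Strict Implicit.
Unset Printing Implicit Defensive.

Import Order.TTheory GRing.Theory Num.Theory.
Import numFieldNormedType.Exports.

Local Open Scope classical_set_scope.
Local Open Scope ring_scope.

Section Definitions.
(* The scalar field is kept generic so that the same definitions serve for
   real and for complex Banach spaces; over [K = R[i]] the norm takes values in
   the nonnegative reals of [R[i]]. *)
Context {K : numFieldType} {E : normedModType K}.
Implicit Types (T U V : {linear E -> E}) (F G : set E).

(* For a linear map this is boundedness on a ball around 0, i.e.
   [`|T x| <= M * `|x|] for some [M] (see [linear_boundedP]). *)
Definition bounded_operator T : Prop := bounded_near T (nbhs (0 : E)).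

Definition id_factors_through T : Prop :=
  exists U V, [/\ bounded_operator U, bounded_operator V & U \o T \o V = id].

Definition closed_linear_subspace F : Prop :=
  submod_closed (mem F) /\ closed F.

Definition finite_dimensional F : Prop :=
  exists (n : nat) (b : 'I_n -> E),
    F = range (fun c : 'I_n -> K => \sum_(i < n) c i *: b i).

Definition infinite_dimensional F : Prop := ~ finite_dimensional F.

Definition whole_is_direct_sum F G : Prop :=
  [set x + y | x in F & y in G] = [set: E] /\ F `&` G = [set 0].

End Definitions.

Definition primary_factorisation_property (K : numFieldType)
    (E : normedModType K) : Prop :=
  forall T : {linear E -> E}, bounded_operator T ->
    id_factors_through T \/ id_factors_through (idfun \- T).

Definition indecomposable (K : numFieldType) (E : normedModType K) : Prop :=
  infinite_dimensional [set: E] /\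
  ~ exists F G : set E,
      [/\ closed_linear_subspace F, infinite_dimensional F,
          closed_linear_subspace G, infinite_dimensional G &
          whole_is_direct_sum F G].

(* Main.v *)
Require Import Defs.
From HB Require Import structures.
From mathcomp Require Import all_boot all_order all_algebra complex.
From mathcomp Require Import boolp classical_sets reals topology normedtype.
From mathcomp Require Import lra.

(* Let P be a bounded rank-one projection (Hahn-Banach).  The identity does not
   factor through P, so U (1 - P) V = 1 for some U and V, and S = (1 - P) V is
   left invertible but not onto.  If 1 factors through T, say U T V = 1, then
   V U T is an idempotent with infinite-dimensional range, so by
   indecomposability V U is a left inverse of T modulo finite rank.  Hence, for
   k != l, one of S - k and S - l is left invertible modulo finite rank, and so
   is S itself: this holds for all S - k with k on one of the real half-lines
   starting at 0.  Along such a half-line, being a bijection plus a finite-rank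
   map is a locally constant property of S - k, and it holds for large k, so it
   holds for S.  But a bijection plus a finite-rank map is onto as soon as it is
   injective: contradiction. *)

Set Implicit Arguments.
Unset Strict Implicit.
Unset Printing Implicit Defensive.

Import Order.TTheory GRing.Theory Num.Theory.

Local Open Scope classical_set_scope.
Local Open Scope ring_scope.

(** * Finite-rank maps and finite-rank perturbations of bijections *)

Section FiniteRank.
Context {K : fieldType} {E : lmodType K}.

Definition spanned_by (n : nat) (b : 'I_n -> E) (x : E) : Prop :=
  exists c : 'I_n -> K, x = \sum_(i < n) c i *: b i.

Definition finite_rank (X : Type) (F : X -> E) : Prop :=
  exists (n : nat) (b : 'I_n -> E), forall x, spanned_by b (F x).

Lemma finite_rankD (X : Type) (F1 F2 : X -> E) :
  finite_rank F1 -> finite_rank F2 -> finite_rank (fun x => F1 x + F2 x).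
Proof.
move=> [m [b1 h1]] [n [b2 h2]].
exists (m + n)%N, (fun i => match split i with inl j => b1 j | inr j => b2 j end).
move=> x; have [c1 ->] := h1 x; have [c2 ->] := h2 x.
exists (fun i => match split i with inl j => c1 j | inr j => c2 j end).
rewrite big_split_ord /=; congr (_ + _); apply: eq_bigr => i _.
  by rewrite (unsplitK (inl i)).
by rewrite (unsplitK (inr i)).
Qed.

Lemma finite_rank_comp (X Y : Type) (F : X -> E) (f : Y -> X) :
  finite_rank F -> finite_rank (F \o f).
Proof. by move=> [n [b h]]; exists n, b => x; apply: h. Qed.

Lemma finite_rank_linear (X : Type) (A : {linear E -> E}) (F : X -> E) :
  finite_rank F -> finite_rank (A \o F).
Proof.
move=> [n [b h]]; exists n, (A \o b) => x /=; have [c ->] := h x.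
by exists c; rewrite linear_sum; apply: eq_bigr => i _; rewrite linearZ.
Qed.

Lemma finite_rankN (X : Type) (F : X -> E) :
  finite_rank F -> finite_rank (fun x => - F x).
Proof.
move=> [n [b h]]; exists n, b => x; have [c ->] := h x.
by exists (fun i => - c i); rewrite -sumrN; apply: eq_bigr => i _; rewrite scaleNr.
Qed.

(** A spanning family of minimal length is free: a relation with [c k != 0] would express [b k]
    through the other vectors and give a shorter family. *)
Lemma finite_rank_basis (X : Type) (F : X -> E) : finite_rank F ->
  exists (n : nat) (b : 'I_n -> E), (forall x, spanned_by b (F x)) /\
    forall c : 'I_n -> K, \sum_(i < n) c i *: b i = 0 -> forall i, c i = 0.
Proof.
move=> finF; pose P n := `[< exists b : 'I_n -> E, forall x, spanned_by b (F x) >].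
have exP : exists n, P n by have [n [b h]] := finF; exists n; apply/asboolP; exists b.
case: (ex_minnP exP) => -[|n] /asboolP[b hb] minn; exists _, b; split=> //.
  by move=> c _ [].
move=> c c0 k; apply: contrapT => /eqP ck.
suff : (n.+1 <= n)%N by rewrite ltnn.
apply: minn; apply/asboolP; exists (b \o lift k) => x.
have bk : b k = \sum_(i < n) (- (c k)^-1 * c (lift k i)) *: b (lift k i).
  move: c0; rewrite (bigD1_ord k) //= => /eqP; rewrite addr_eq0 => /eqP c0.
  rewrite -[LHS](scalerK ck) c0 scalerN scaler_sumr -sumrN.
  by apply: eq_bigr => i _; rewrite scalerA mulNr scaleNr.
have [d ->] := hb x.
exists (fun i => d k * (- (c k)^-1 * c (lift k i)) + d (lift k i)).
rewrite (bigD1_ord k) //= bk scaler_sumr -big_split /=.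
by apply: eq_bigr => i _; rewrite scalerDl scalerA.
Qed.

(** [T] maps the span of [b] into itself with matrix [M], which injectivity makes invertible. As
    [T y - y] lies in this span, it is the image of some vector there, and subtracting that vector
    from [y] gives a preimage of [y]. *)
Lemma injective_id_plus_finite_rank_surjective (T : {linear E -> E}) :
  finite_rank (fun x => T x - x) -> injective T -> forall y, exists x, T x = y.
Proof.
move=> /finite_rank_basis[n [b [hb free_b]]] injT y.
pose comb (a : 'rV[K]_n) := \sum_(i < n) a 0 i *: b i.
have comb0 a : comb a = 0 -> a = 0.
  by move=> /free_b a0; apply/rowP => i; rewrite mxE a0.
have [m hm] := choice (fun j => hb (b j)).
pose M : 'M[K]_n := 1%:M + \matrix_(j, i) m j i.
have Tcomb a : T (comb a) = comb (a *m M).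
  rewrite mulmxDr mulmx1 linear_sum /=; under eq_bigr do rewrite linearZ /=.
  under eq_bigr => j _ do rewrite -[T (b j)](subrK (b j)) hm addrC scalerDr scaler_sumr.
  rewrite big_split exchange_big /= -big_split; apply: eq_bigr => i _ /=.
  rewrite !mxE scalerDl scaler_suml; congr (_ + _); apply: eq_bigr => j _.
  by rewrite scalerA mxE.
have unitM : M \in unitmx.
  rewrite -row_free_unit -kermx_eq0; apply/rowV0P => a /sub_kermxP aM0.
  by apply/comb0/injT; rewrite Tcomb aM0 linear0 /comb big1 // => i _; rewrite mxE scale0r.
have [c Fy] := hb y.
exists (y - comb ((\row_i c i) *m invmx M)).
rewrite linearB /= Tcomb mulmxKV //.
have -> : comb (\row_i c i) = T y - y.
  by rewrite Fy; apply: eq_bigr => i _; rewrite mxE.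
by rewrite subKr.
Qed.

(* For operators this is the class of Fredholm operators of index zero. *)
Definition index_zero (T : E -> E) : Prop :=
  exists G H : {linear E -> E},
    [/\ cancel G H, cancel H G & finite_rank (fun x => T x - G x)].

(** Composing with the inverse [H] of the bijective part turns [T] into the identity plus a
    finite-rank map. *)
Lemma index_zero_injective_surjective (T : {linear E -> E}) :
  index_zero T -> injective T -> forall y, exists x, T x = y.
Proof.
move=> [G [H [GK HK finF]]] injT y.
have [| |x Tx] := @injective_id_plus_finite_rank_surjective (H \o T) _ _ (H y).
- have -> : (fun x => (H \o T) x - x) = H \o (fun x => T x - G x).
    by apply/funext => x /=; rewrite linearB /= GK.
  exact: finite_rank_linear.
- exact: inj_comp (can_inj HK) injT.
- by exists x; apply: (can_inj HK).
Qed.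

(** Modulo finite rank, [A] is [A \o B] followed by an inverse of [B] on the right, so [G \o H1] is
    its bijective part. *)
Lemma index_zero_left (A B : {linear E -> E}) :
  index_zero (A \o B) -> index_zero B -> index_zero A.
Proof.
move=> [G [H [GK HK finAB]]] [G1 [H1 [G1K H1K finB]]].
exists (G \o H1), (G1 \o H); split.
- by move=> x /=; rewrite GK H1K.
- by move=> x /=; rewrite G1K HK.
have -> : (fun x => A x - (G \o H1) x) =
    fun x => ((fun x => (A \o B) x - G x) \o H1) x -
             (A \o ((fun x => B x - G1 x) \o H1)) x.
  by apply/funext => x /=; rewrite linearB /= H1K opprB [RHS]addrC subrKA.
apply: finite_rankD; first exact: finite_rank_comp.
exact/finite_rankN/finite_rank_linear/finite_rank_comp.
Qed.

Lemma index_zero_right (A B : {linear E -> E}) :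
  index_zero (A \o B) -> index_zero A -> index_zero B.
Proof.
move=> [G [H [GK HK finAB]]] [G1 [H1 [G1K H1K finA]]].
exists (H1 \o G), (H \o G1); split.
- by move=> x /=; rewrite H1K GK.
- by move=> x /=; rewrite HK G1K.
have -> : (fun x => B x - (H1 \o G) x) =
    fun x => (H1 \o (fun x => (A \o B) x - G x)) x -
             (H1 \o ((fun x => A x - G1 x) \o B)) x.
  by apply/funext => x /=; rewrite -linearB /= opprB (addrC (_ - G x)) subrKA linearB /= G1K.
apply: finite_rankD; first exact: finite_rank_linear.
exact/finite_rankN/finite_rank_linear/finite_rank_comp.
Qed.

End FiniteRank.

(** * Linear inverses, and local constancy on a half-line *)

Lemma linear_bundle (K : pzRingType) (V W : lmodType K) (f : V -> W) :
  linear f -> exists F : {linear V -> W}, F = f :> (V -> W).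
Proof.
move=> lf; pose H := GRing.isLinear.Build K V W *:%R f lf.
pose F : {linear V -> W} := HB.pack f H.
by exists F.
Qed.

Lemma linear_inverse (K : pzRingType) (V : lmodType K) (G : {linear V -> V}) :
  injective G -> (forall y, exists x, G x = y) ->
  exists H : {linear V -> V}, cancel G H /\ cancel H G.
Proof.
move=> injG /choice[h hK]; have [H Hh] : exists H : {linear V -> V}, H = h :> (V -> V).
  by apply: linear_bundle => a x y; apply: injG; rewrite linearP !hK.
by exists H; split=> x; [apply: injG|]; rewrite Hh hK.
Qed.

(** Let [L] be the set of points where [P] holds. Local constancy puts [inf L] into [L]; if [inf L]
    were positive, it would also put slightly smaller points there. *)
Lemma locally_constant_half_line (R : realType) (P : R -> Prop) :
  (forall t, 0 <= t -> exists2 d, 0 < d &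
    forall u, 0 <= u -> `|u - t| < d -> P u <-> P t) ->
  (exists2 m, 0 <= m & P m) -> P 0.
Proof.
move=> locP [m m0 Pm]; pose L := [set t | 0 <= t /\ P t].
have infL : has_inf L by split; [exists m | exists 0 => t []].
have t0 : 0 <= inf L by apply: lb_le_inf; [exists m | move=> t []].
have [d d0 Pd] := locP _ t0.
have [u [u0 Pu] utd] := inf_adherent d0 infL.
have tu : inf L <= u by apply: ge_inf => //; exact: infL.2.
have Pt : P (inf L).
  by apply/(Pd u) => //; rewrite ger0_norm ?subr_ge0// ltrBlDl.
move: t0; rewrite le_eqVlt => /orP[/eqP ->//|tgt0].
(* The two bounds keep [inf L - e] within distance [d] of [inf L] and on the half-line. *)
pose e := Num.min (d / 2) (inf L).
have e0 : 0 < e by rewrite lt_min divr_gt0.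
have et : e <= inf L by rewrite ge_min lexx orbT.
have ed : e < d by rewrite (@le_lt_trans _ _ (d / 2)) ?ge_min ?lexx// ltr_pdivrMr// ltr_pMr// ltr1n.
have Le : L (inf L - e).
  split; first by rewrite subr_ge0.
  by apply/Pd; rewrite ?subr_ge0// addrAC subrr add0r normrN gtr0_norm.
have : inf L <= inf L - e by apply: ge_inf => //; exact: infL.2.
by rewrite lerDl oppr_ge0 leNgt e0.
Qed.

(** * Order facts carried from the reals to the scalar field *)

Section RealStructure.
(* [K] is [R] or [R[i]]; [iota] embeds the real line into [K]. *)
Context {R : realType} {K : numFieldType} (iota : {rmorphism R -> K}).
Hypothesis iota_ge0 : forall r : R, 0 <= r -> 0 <= iota r.
Hypothesis iota_onto : forall k : K, 0 <= k -> exists2 r, 0 <= r & k = iota r.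

Let iota_gt0 r : 0 < r -> 0 < iota r.
Proof. by move=> r0; rewrite lt_neqAle iota_ge0 ?ltW// eq_sym fmorph_eq0 gt_eqF. Qed.

Let iota_lt r s : r < s -> iota r < iota s.
Proof. by move=> rs; rewrite -subr_gt0 -rmorphB iota_gt0// subr_gt0. Qed.

Let iota_norm r : `|iota r| = iota `|r|.
Proof.
have [r0|r0] := leP 0 r; first by rewrite (ger0_norm r0) ger0_norm ?iota_ge0.
by rewrite -normrN -rmorphN (ltr0_norm r0) ger0_norm ?iota_ge0// oppr_ge0 ltW.
Qed.

Let iota_onto_gt0 k : 0 < k -> exists2 r, 0 < r & k = iota r.
Proof.
move=> k0; have [r r0 kr] := iota_onto (ltW k0).
exists r => //; rewrite lt_neqAle r0 andbT eq_sym.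
by apply: contraTneq k0 => r_eq0; rewrite kr r_eq0 rmorph0 ltxx.
Qed.

(** The Archimedean property is available in [R], and nonnegative scalars of [K] come from [R]. *)
Let geometric_small (C e : K) : 0 <= C -> 0 < e -> exists n, C * 2^-1 ^+ n < e.
Proof.
move=> /iota_onto[c c0 ->] /iota_onto_gt0[d d0 ->].
have := @upper_nthrootP _ (c / d) _ (leqnn _); set n := Num.bound _ => cd.
exists n; rewrite exprVn ltr_pdivrMr ?exprn_gt0 ?ltr0n//.
have -> : (2 ^+ n : K) = iota (2 ^+ n) by rewrite rmorphXn /= rmorph_nat.
by rewrite -rmorphM iota_lt// mulrC -ltr_pdivrMr.
Qed.

(** * Bounded operators and the Neumann series *)

Section Operators.
Context {E : completeNormedModType K}.
Implicit Types (A B D S T U V : {linear E -> E}).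

Lemma bounded_operatorP T : bounded_operator T <->
  exists2 m : R, 0 <= m & forall x, `|T x| <= iota m * `|x|.
Proof.
split.
- move=> /linear_boundedP[M [Mreal hM]].
  (* [M] bounds through all real numbers above it; [|M| + 1] is one of them and, being nonnegative,
     comes from [R]. *)
  have [m m0 km] : exists2 r, 0 <= r & `|M| + 1 = iota r by apply: iota_onto; rewrite addr_ge0.
  exists m => // x; rewrite -km; apply: hM.
  by rewrite (le_lt_trans (real_ler_norm Mreal))// ltrDl.
- move=> [m m0 hT]; apply/linear_boundedP; exists (iota m); split.
    exact/ger0_real/iota_ge0.
  by move=> r mr x; rewrite (le_trans (hT x))// ler_wpM2r// ltW.
Qed.

(** The iterates of [x |-> y + D x] from 0 are the partial sums of the Neumann series. They stay
    within [2 * |y|], so applying [D] [n] times shows that they form a Cauchy sequence. *)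
Lemma id_minus_contraction_surjective D : (forall x, `|D x| <= 2^-1 * `|x|) ->
  forall y, exists x, x - D x = y.
Proof.
move=> hD y; pose u n := iter n (fun x => y + D x) 0.
have half0 : 0 <= 2^-1 :> K by rewrite invr_ge0.
have u_bnd k : `|u k| <= 2 * `|y|.
  elim: k => [|k IH]; first by rewrite normr0 mulr_ge0.
  rewrite /= (le_trans (ler_normD _ _))// mulrDl mul1r lerD2l (le_trans (hD _))//.
  by rewrite ler_pdivrMl.
have u_dist n k : `|u (n + k)%N - u n| <= 2 * `|y| * 2^-1 ^+ n.
  elim: n => [|n IH]; first by rewrite add0n subr0 mulr1.
  rewrite /= opprD addrACA subrr add0r -linearB (le_trans (hD _))//.
  by rewrite exprS mulrCA ler_wpM2l.
have cvg_u : cvg (u @ \oo).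
  apply/cauchy_cvgP/cauchy_exP => e e0.
  have [n hn] := geometric_small (mulr_ge0 (ler0n _ 2) (normr_ge0 y)) e0.
  exists (u n), n => // m /= nm; rewrite -ball_normE /= distrC.
  by rewrite -(subnKC nm) (le_lt_trans (u_dist _ _)).
(* If [l] were not a solution, the defect [l - D l - y] would be a difference of two vectors, each
   of norm at most a quarter of the norm of the defect. *)
pose l := lim (u @ \oo); exists l; apply/eqP; rewrite -subr_eq0; apply: contrapT => /negP nz.
have e0 : 0 < `|l - D l - y| / 4 by rewrite divr_gt0 ?normr_gt0.
have [N _ hN] := cvg_ball cvg_u e0.
have {}hN n : (N <= n)%N -> `|l - u n| < `|l - D l - y| / 4.
  by move=> Nn; have := hN n Nn; rewrite -ball_normE.
have : `|l - D l - y| <= `|l - D l - y| / 4 + `|l - D l - y| / 4.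
  have E1 : l - D l - y = (l - u N.+1) - D (l - u N).
    rewrite linearB /= opprB opprD [in RHS]addrA [in RHS]addrAC.
    by rewrite -!addrA; congr (_ + _); rewrite addrCA [RHS]addrC -!addrA subrr addr0 addrC.
  rewrite {1}E1 (le_trans (ler_normB _ _))//; apply: lerD; first exact: ltW (hN N.+1 (leqnSn N)).
  rewrite ltW// (le_lt_trans (hD _))// (le_lt_trans _ (hN N _))//.
  by rewrite ler_piMl// invf_le1 ?ler1n.
rewrite -mulrDr => /le_gtF/negbT/negP[].
rewrite gtr_pMr ?normr_gt0//.
by rewrite -mulr2n -(mulr_natl _^-1) ltr_pdivrMr ?mul1r ?ltr_nat ?ltr0n.
Qed.

Lemma id_minus_contraction_bijective D : (forall x, `|D x| <= 2^-1 * `|x|) ->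
  exists H : {linear E -> E}, cancel (idfun \- D) H /\ cancel H (idfun \- D).
Proof.
move=> hD; apply: linear_inverse; last exact: id_minus_contraction_surjective.
suff D0 x : x - D x = 0 -> x = 0.
  move=> x y /= xy; apply/subr0_eq/D0.
  by rewrite linearB opprB (addrC (D y)) addrACA xy (addrC (- y)) subrKA subrr.
move=> /subr0_eq xD; apply/eqP; rewrite -normr_eq0 eq_le normr_ge0 andbT.
have := hD x; rewrite -xD -[X in X <= _]mul1r -subr_le0 -mulrBl.
by rewrite pmulr_rle0// subr_gt0 invf_lt1// ltr1n.
Qed.

Lemma bounded_operator_comp A B :
  bounded_operator A -> bounded_operator B -> bounded_operator (A \o B).
Proof.
move=> /bounded_operatorP[a a0 ha] /bounded_operatorP[b b0 hb].
apply/bounded_operatorP; exists (a * b) => [|x]; first exact: mulr_ge0.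
by rewrite /= (le_trans (ha _))// rmorphM -mulrA ler_wpM2l// iota_ge0.
Qed.

Lemma bounded_operatorZ k A : bounded_operator A -> bounded_operator (k \*: A).
Proof.
move=> /bounded_operatorP[a a0 ha].
have [c c0 kc] := iota_onto (normr_ge0 k).
apply/bounded_operatorP; exists (c * a) => [|x]; first exact: mulr_ge0.
by rewrite /= normrZ kc rmorphM -mulrA ler_wpM2l// iota_ge0.
Qed.

Lemma bounded_operator_id : bounded_operator (idfun : {linear E -> E}).
Proof. by apply/bounded_operatorP; exists 1 => // x; rewrite rmorph1 mul1r. Qed.

Lemma bounded_operatorB A B :
  bounded_operator A -> bounded_operator B -> bounded_operator (A \- B).
Proof.
move=> /bounded_operatorP[a a0 ha] /bounded_operatorP[b b0 hb].
apply/bounded_operatorP; exists (a + b) => [|x]; first exact: addr_ge0.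
by rewrite /= (le_trans (ler_normB _ _))// rmorphD mulrDl lerD.
Qed.

Lemma closed_ker T : bounded_operator T -> closed_linear_subspace [set x | T x = 0].
Proof.
move=> bT; split.
  split; first by rewrite inE /= linear0.
  by move=> a x y; rewrite !inE /= => Tx Ty; rewrite linearP Tx Ty scaler0 addr0.
have /continuous_closedP/(_ [set 0]) := (linear_bounded_continuous T).1 bT.
by apply; exact/accessible_closed_set1/hausdorff_accessible/norm_hausdorff.
Qed.

(** * Left invertibility modulo finite rank, and shifts of an operator *)

Definition shift T (k : K) : {linear E -> E} := T \- k \*: idfun.

(** For bounded operators on a Banach space these are the left semi-Fredholm operators:
    finite-dimensional kernel and complemented range. *)
Definition left_fredholm T : Prop :=
  exists2 A : {linear E -> E}, bounded_operator A & finite_rank (fun x => A (T x) - x).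

Lemma left_fredholmZ k T : left_fredholm (k \*: T) -> left_fredholm T.
Proof.
move=> [A bA finA]; exists (k \*: A); first exact: bounded_operatorZ.
have -> : (fun x => (k \*: A) (T x) - x) = (fun x => A ((k \*: T) x) - x) => //.
by apply/funext => x /=; rewrite linearZ.
Qed.

Lemma id_factors_left_fredholm T : indecomposable E ->
  bounded_operator T -> id_factors_through T -> left_fredholm T.
Proof.
move=> [infE indecE] bT [U [V [bU bV UTV]]].
have UTVx x : U (T (V x)) = x by rewrite -[RHS](congr1 (fun f => f x) UTV).
have [P PE bP] : exists2 P : {linear E -> E}, (forall x, P x = V (U (T x))) & bounded_operator P.
  by exists (V \o (U \o T)) => //; do 2?apply: bounded_operator_comp.
have PV x : P (V x) = V x by rewrite PE UTVx.
have PP x : P (P x) = P x by rewrite PE PE UTVx.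
have [Q QE bQ] : exists2 Q : {linear E -> E}, (forall x, Q x = x - P x) & bounded_operator Q.
  exists (idfun \- P) => //; apply: bounded_operatorB => //; exact: bounded_operator_id.
have PQ x : P (Q x) = 0 by rewrite QE linearB /= PP subrr.
(* [V \o U \o T] differs from the identity by [- Q], whose values lie in the kernel of [P]. *)
suff [n [b hb]] : finite_dimensional [set x | P x = 0].
  exists (V \o U); first exact: bounded_operator_comp.
  exists n, b => x; have : [set x | P x = 0] (- Q x) by rewrite /= linearN /= PQ oppr0.
  by rewrite hb => -[c _ cQ]; exists c; rewrite cQ QE opprB PE.
(* The kernel of [Q] is the range of [P]; it contains the range of [V], so [U \o T] maps it onto
   [E]. *)
have infQ : infinite_dimensional [set x | Q x = 0].
  move=> [n [b hb]]; apply: infE; exists n, (U \o (T \o b)).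
  apply/seteqP; split=> // x _.
  have : [set x | Q x = 0] (V x) by rewrite /= QE PV subrr.
  rewrite hb => -[c _ Vx]; exists c => //=.
  rewrite -[RHS]UTVx -Vx !linear_sum; apply: eq_bigr => i _.
  by rewrite !linearZ.
apply: contrapT => infP; apply: indecE; exists [set x | P x = 0], [set x | Q x = 0].
split=> //; [exact: closed_ker|exact: closed_ker|split].
  apply/seteqP; split=> // x _; exists (Q x) => //.
  by exists (P x); [rewrite /= QE PP subrr | rewrite QE subrK].
apply/seteqP; split=> [x [/= Px /eqP]|x -> /=]; last by rewrite !linear0.
by rewrite QE Px subr0 => /eqP.
Qed.

(* If A T = 1 + F with F of finite rank, then A (T - s) = (1 - s A) + F, where
   1 - s A is a bijection for small s. *)
Lemma index_zero_locally_constant T : left_fredholm T ->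
  exists2 d : R, 0 < d &
    forall s, `|s| < d -> index_zero (shift T (iota s)) <-> index_zero T.
Proof.
move=> [A /bounded_operatorP[a a0 hA] finA].
have a1 : 0 < a + 1 by rewrite ltr_wpDl.
(* This radius makes [s A] a contraction with constant 1/2; [a + 1] replaces [a] because [a] may be
   0. *)
exists (2 * (a + 1))^-1; first by rewrite invr_gt0 mulr_gt0.
move=> s sd.
have AT : index_zero (A \o T).
  by exists idfun, idfun; split.
have AS : index_zero (A \o shift T (iota s)).
  have [x|H [DK HK]] := @id_minus_contraction_bijective (iota s \*: A).
    rewrite /= normrZ iota_norm (le_trans (ler_wpM2l _ (hA x))) ?iota_ge0// mulrA ler_wpM2r//.
    have -> : (2^-1 : K) = iota 2^-1 by rewrite fmorphV rmorph_nat.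
    rewrite -rmorphM -subr_ge0 -rmorphB iota_ge0// subr_ge0.
    rewrite (le_trans (ler_wpM2r a0 (ltW sd)))// invfM -mulrA ler_piMr ?invr_ge0//.
    by rewrite ler_pdivrMl// mulr1 lerDl.
  exists (idfun \- iota s \*: A), H; split=> //.
  have -> // : (fun x => (A \o shift T (iota s)) x - (idfun \- iota s \*: A) x) =
      fun x => A (T x) - x.
  by apply/funext => x /=; rewrite linearB linearZ /= opprB addrA subrK.
(* Both [A \o T] and [A \o shift T (iota s)] have index zero, so the property passes from either
   right factor to [A] and from [A] to the other one. *)
by split=> h; [apply: (index_zero_right AT) | apply: (index_zero_right AS)];
  [apply: (index_zero_left AS) | apply: (index_zero_left AT)].
Qed.

(** For [k = e * m] one has [T - k = - k (1 - T / k)], and [m = 2 * (a + 1)] makes [T / k] a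
    contraction with constant 1/2; the shift is then itself a bijection. *)
Lemma index_zero_large_shift T (e : R) : `|e| = 1 -> bounded_operator T ->
  exists2 m : R, 0 <= m & index_zero (shift T (iota (e * m))).
Proof.
move=> e1 /bounded_operatorP[a a0 hT].
have a1 : 0 < 2 * (a + 1) by rewrite mulr_gt0// ltr_wpDl.
pose m := 2 * (a + 1); exists m; first exact: ltW.
have e0 : e != 0 by rewrite -normr_gt0 e1.
have m0 : e * m != 0 by rewrite mulf_neq0// gt_eqF.
have k0 : iota (e * m) != 0 by rewrite fmorph_eq0.
have [x|H [DK HK]] := @id_minus_contraction_bijective ((iota (e * m))^-1 \*: T).
  rewrite /= normrZ normfV iota_norm normrM e1 mul1r gtr0_norm// ler_pdivrMl ?iota_gt0//.
  rewrite (le_trans (hT x))// mulrA ler_wpM2r//.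
  rewrite rmorphM rmorph_nat mulrAC mulfV ?pnatr_eq0// mul1r.
  by rewrite -subr_ge0 -rmorphB iota_ge0// addrAC subrr add0r.
exists (shift T (iota (e * m))), (H \o (- (iota (e * m))^-1 \*: idfun)).
have shiftE x : (shift T (iota (e * m))) x = - iota (e * m) *: (x - (iota (e * m))^-1 *: T x).
  by rewrite /= scalerBr !scaleNr opprK scalerA mulfV// scale1r addrC.
split=> [x|x|].
- rewrite [in LHS]shiftE /= scalerA mulrNN mulVf// scale1r; exact: DK.
- rewrite [in LHS]shiftE; have := HK (- (iota (e * m))^-1 *: x) => /= ->.
  by rewrite scalerA mulrNN mulfV// scale1r.
- by exists 0%N, (fun _ => 0) => x; exists (fun _ => 0); rewrite big_ord0 subrr.
Qed.

Lemma index_zero_ray S (e : R) : `|e| = 1 -> bounded_operator S ->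
  (forall t, 0 <= t -> left_fredholm (shift S (iota (e * t)))) -> index_zero S.
Proof.
move=> e1 bS fredS.
suff : index_zero (shift S (iota (e * 0))).
  rewrite mulr0 rmorph0; congr index_zero.
  by apply/funext => x /=; rewrite scale0r subr0.
apply: (@locally_constant_half_line R (fun t => index_zero (shift S (iota (e * t))))).
  move=> t t0; have [d d0 hd] := index_zero_locally_constant (fredS t t0).
  (* Since [|e| = 1], moving from [t] to [u] shifts the operator further by a scalar of size
     [|u - t|]. *)
  exists d => // u _ ud; rewrite -(hd (e * (u - t))); last by rewrite normrM e1 mul1r.
  have -> // : shift S (iota (e * u)) =
      shift (shift S (iota (e * t))) (iota (e * (u - t))) :> (E -> E).
  by apply/funext => x /=; rewrite mulrBr rmorphB scalerBl opprB subrKA.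
exact: index_zero_large_shift.
Qed.

(* The essential spectrum of an operator has at most one point. *)
Lemma left_fredholm_shift S k l :
  indecomposable E -> primary_factorisation_property E -> bounded_operator S ->
  k != l -> left_fredholm (shift S k) \/ left_fredholm (shift S l).
Proof.
move=> indE pfpE bS kl.
(* The scaling is chosen so that [1 - c (S - k) = - c (S - l)]. *)
pose c := (l - k)^-1; pose T : {linear E -> E} := c \*: shift S k.
have bshift m : bounded_operator (shift S m).
  by apply: bounded_operatorB => //; apply/bounded_operatorZ/bounded_operator_id.
have bT : bounded_operator T by apply: bounded_operatorZ.
have [fT|fT] := pfpE T bT; [left|right].
  exact/(@left_fredholmZ c)/id_factors_left_fredholm.
have TE : idfun \- T = (- c) \*: shift S l :> (E -> E).
  apply/funext => x /=; have {1}-> : x = c *: (l *: x - k *: x).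
    by rewrite -scalerBl scalerA mulVf ?scale1r// subr_eq0 eq_sym.
  by rewrite -scalerBr opprB subrKA scaleNr -scalerN opprB.
apply/(@left_fredholmZ (- c))/id_factors_left_fredholm => //; first exact: bounded_operatorZ.
(* The two operators agree as functions but are different bundled maps, so the factorisation is
   carried over pointwise. *)
have [U [V [bU bV UTV]]] := fT; exists U, V; split=> //.
apply/funext => x; rewrite -[RHS](congr1 (fun g => g x) UTV) /=.
by rewrite -[LHS]/(U (((- c) \*: shift S l) (V x))) -TE.
Qed.

Lemma indecomposable_not_primary (f : E -> K) (x0 : E) :
  scalar f -> f x0 = 1 -> (exists2 M : K, 0 <= M & forall x, `|f x| <= M * `|x|) ->
  indecomposable E -> ~ primary_factorisation_property E.
Proof.
move=> linf fx0 [M M0 fM] indE pfpE.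
have [P PE] : exists P : {linear E -> E}, P = (fun x => f x *: x0) :> (E -> E).
  by apply: linear_bundle => a x y; rewrite linf scalerDl scalerA.
have [c c0 Mc] := iota_onto (mulr_ge0 M0 (normr_ge0 x0)).
have bP : bounded_operator P.
  apply/bounded_operatorP; exists c => // x.
  by rewrite PE -Mc normrZ mulrAC ler_wpM2r.
have [|] := pfpE P bP => -[U [V [bU bV UPV]]].
  (* Factoring through [P] would make every vector a multiple of [U x0]. *)
  apply: indE.1; exists 1%N, (fun _ => U x0); apply/seteqP; split=> // x _.
  exists (fun _ => f (V x)) => //; rewrite big_ord1 -linearZ.
  by rewrite -[RHS](congr1 (fun g => g x) UPV) /= PE.
pose S : {linear E -> E} := (idfun \- P) \o V.
have US x : U (S x) = x by rewrite -[RHS](congr1 (fun g => g x) UPV).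
have bS : bounded_operator S.
  by apply: bounded_operator_comp => //; apply: bounded_operatorB => //; exact: bounded_operator_id.
(* The functional [f] vanishes on the range of [1 - P], hence on that of [S], which therefore misses
   [x0]. *)
have fS x : f (S x) = 0.
  by rewrite /S /= PE addrC -scaleNr linf fx0 mulr1 addNr.
suff /index_zero_injective_surjective surjS : index_zero S.
  have [x Sx] := surjS (can_inj US) x0.
  by have := fS x; rewrite Sx fx0 => /eqP; rewrite oner_eq0.
have fredS : left_fredholm S.
  exists U => //; exists 0%N, (fun _ => 0) => x; exists (fun _ => 0).
  by rewrite big_ord0 US subrr.
have fredS0 e : left_fredholm (shift S (iota (e * 0))).
  have [A bA finA] := fredS; exists A => //.
  have -> // : (fun x => A (shift S (iota (e * 0)) x) - x) = (fun x => A (S x) - x).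
  by apply/funext => x /=; rewrite mulr0 rmorph0 scale0r subr0.
(* Either the positive half-line works, or some shift by [t > 0] fails; comparison with this [t]
   then settles every negative shift. *)
have [pos|/existsNP[t /not_implyP[t0 nt]]] :=
    pselect (forall t, 0 < t -> left_fredholm (shift S (iota (1 * t)))).
  apply: (@index_zero_ray S 1) => // [|t]; first exact: normr1.
  by rewrite le_eqVlt => /orP[/eqP <-|/pos].
apply: (@index_zero_ray S (-1)) => // [|u]; first by rewrite normrN normr1.
rewrite le_eqVlt => /orP[/eqP <-//|u0].
have kl : iota (1 * t) != iota (-1 * u).
  rewrite (inj_eq (fmorph_inj _)) mul1r mulN1r gt_eqF//.
  by rewrite (@lt_trans _ _ 0)// oppr_lt0.
by have [/nt|] := left_fredholm_shift indE pfpE bS kl.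
Qed.

End Operators.
End RealStructure.

(** * The Hahn-Banach theorem for a real seminorm *)

Section HahnBanach.
Context {R : realType} {V : lmodType R} (p : V -> R).
Hypothesis pD : forall x y, p (x + y) <= p x + p y.
Hypothesis pZ : forall (t : R) x, p (t *: x) = `|t| * p x.

Implicit Types g : set (V * R).

(* Partial functionals are graphs; domination forces a linear graph to be
   single-valued. *)
Let linear_graph g := forall a x r y s, g (x, r) -> g (y, s) -> g (a *: x + y, a * r + s).
Let dominated g := forall x r, g (x, r) -> r <= p x.

Let linear_graph0 g x r : linear_graph g -> g (x, r) -> g (0, 0).
Proof. by move=> lg gx; have := lg (-1) _ _ _ _ gx gx; rewrite scaleN1r mulN1r !addNr. Qed.

Let linear_graphZ g a x r : linear_graph g -> g (x, r) -> g (a *: x, a * r).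
Proof.
by move=> lg gx; have := lg a _ _ _ _ gx (linear_graph0 lg gx); rewrite !addr0.
Qed.

(** The value [a] at [v] has to lie between all [r - p (x - v)] and all [p (y + v) - s].
    Subadditivity orders these two families, and the supremum of the first one serves. *)
Let graph_extension g v : g (0, 0) -> linear_graph g -> dominated g ->
  exists g', [/\ linear_graph g', dominated g', g `<=` g' & exists a, g' (v, a)].
Proof.
move=> g0 lg dg.
pose B := [set z | exists x r, g (x, r) /\ z = r - p (x - v)].
have B0 : B (0 - p (0 - v)) by exists 0, 0.
have ubB y s : g (y, s) -> ubound B (p (y + v) - s).
  move=> gy z [x [r [gx ->]]].
  have := dg _ _ (lg 1 _ _ _ _ gx gy); rewrite scale1r mul1r.
  by have := pD (x - v) (y + v); rewrite addrACA addNr addr0; lra.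
pose a := sup B.
have a_le y s : g (y, s) -> a <= p (y + v) - s.
  by move=> gy; apply: ge_sup; [exists (0 - p (0 - v)) | exact: ubB].
have a_ge x r : g (x, r) -> r - p (x - v) <= a.
  by move=> gx; apply: ub_le_sup; [exists (p (0 + v) - 0); exact: ubB | exists x, r].
exists [set u | exists x r t, g (x, r) /\ u = (x + t *: v, r + t * a)]; split.
- move=> c _ _ _ _ [x [r [t [gx [-> ->]]]]] [y [s [u [gy [-> ->]]]]].
  exists (c *: x + y), (c * r + s), (c * t + u); split; first exact: lg.
  congr pair; first by rewrite scalerDr scalerDl scalerA addrACA.
  by rewrite mulrDr mulrDl mulrA addrACA.
- move=> _ _ [x [r [t [gx [-> ->]]]]].
  (* Dividing by [|t|] reduces to adding or subtracting [v] itself, that is, to the two bounds on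
     [a]. *)
  have [t0|t0|->] := ltgtP t 0; last by rewrite scale0r mul0r !addr0 dg.
    have u0 : 0 < - t by rewrite oppr_gt0.
    have -> : p (x + t *: v) = - t * p ((- t)^-1 *: x - v).
      rewrite -[X in X * _](gtr0_norm u0) -pZ scalerBr scalerA mulfV ?gt_eqF//.
      by rewrite scale1r scaleNr opprK.
    have := a_ge _ _ (linear_graphZ (- t)^-1 lg gx).
    by rewrite -(ler_pM2l u0) mulrBr mulVKf ?gt_eqF//; lra.
  have -> : p (x + t *: v) = t * p (t^-1 *: x + v).
    by rewrite -[X in X * _](gtr0_norm t0) -pZ scalerDr scalerA mulfV ?gt_eqF// scale1r.
  have := a_le _ _ (linear_graphZ t^-1 lg gx).
  by rewrite -(ler_pM2l t0) mulrBr mulVKf ?gt_eqF//; lra.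
- by move=> [x r] gx; exists x, r, 0; rewrite scale0r mul0r !addr0.
- by exists a, 0, 0, 1; rewrite scale1r mul1r !add0r.
Qed.

(** A maximal dominated linear graph through [(x0, p x0)] is defined everywhere, by one-dimensional
    extension. Domination at [x] and [- x] bounds the absolute value. *)
Lemma hahn_banach_seminorm (x0 : V) : exists f : V -> R,
  [/\ scalar f, f x0 = p x0 & forall x, `|f x| <= p x].
Proof.
have p0 : p 0 = 0 by have := pZ 0 0; rewrite scale0r normr0 mul0r.
have pN x : p (- x) = p x by rewrite -scaleN1r pZ normrN normr1 mul1r.
have p_ge0 x : 0 <= p x by have := pD x (- x); rewrite subrr p0 pN; lra.
(* [set0] is allowed because it is the union of the empty chain. *)
pose P g := [/\ linear_graph g, dominated g & g = set0 \/ g (x0, p x0)].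
have [F FP Ftot|g [[lg dg g_or] gmax]] := @Zorn_bigcup (V * R)%type P.
  split.
  - move=> a x r y s [g Fg gx] [h Fh hy].
    have [gh|hg] := Ftot _ _ Fg Fh.
      by exists h => //; have [lh _ _] := FP _ Fh; apply: lh => //; exact: gh.
    by exists g => //; have [lg _ _] := FP _ Fg; apply: lg => //; exact: hg.
  - by move=> x r [g Fg gx]; have [_ + _] := FP _ Fg; apply.
  - have [[g Fg gx]|nF] := pselect (exists2 g, F g & g (x0, p x0)).
      by right; exists g.
    left; apply/seteqP; split=> // u [g Fg gu].
    have [_ _ [g0|gx]] := FP _ Fg; first by rewrite -g0.
    by case: nF; exists g.
(* The empty graph is not maximal: the line spanned by [(x0, p x0)] is admissible and larger. *)
have gx0 : g (x0, p x0).
  case: g_or => // g0; pose h := [set u | exists t, u = (t *: x0, t * p x0)].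
  have hx0 : h (x0, p x0) by exists 1; rewrite scale1r mul1r.
  case: (gmax h).
    by rewrite g0; split; [exact: sub0set | move=> /(_ _ hx0)].
  split; last by right.
    move=> a _ _ _ _ [t [-> ->]] [u [-> ->]]; exists (a * t + u).
    by rewrite scalerA -scalerDl mulrA -mulrDl.
  by move=> _ _ [t [-> ->]]; rewrite pZ ler_wpM2r// ler_norm.
have g_total v : exists r, g (v, r).
  apply: contrapT => nv.
  have [g' [lg' dg' gg' [a g'v]]] := graph_extension v (linear_graph0 lg gx0) lg dg.
  apply: (gmax g'); last by split=> //; right; exact: gg'.
  by split=> // g'g; apply: nv; exists a; exact: g'g.
have g_fun x r s : g (x, r) -> g (x, s) -> r = s.
  have le x1 r1 s1 : g (x1, r1) -> g (x1, s1) -> r1 <= s1.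
    move=> g1 g2; have := dg _ _ (lg (-1) _ _ _ _ g2 g1).
    by rewrite scaleN1r addNr p0 mulN1r; lra.
  by move=> g1 g2; apply/eqP; rewrite eq_le !(le x).
have [f fg] := choice g_total; exists f; split.
- by move=> a x y; apply: g_fun (fg _) _; exact: lg.
- exact: g_fun (fg _) gx0.
- move=> x; rewrite ler_norml (dg x)// andbT lerNl -pN; apply: (dg (- x)).
  by have := linear_graphZ (-1) lg (fg x); rewrite scaleN1r mulN1r.
Qed.

End HahnBanach.

(** * Restriction of complex scalars to the reals *)

Definition realified (R : rcfType) (E : lmodType R[i]) : Type := E.

Section Realified.
Context {R : rcfType} {E : lmodType R[i]}.
HB.instance Definition _ := GRing.Zmodule.on (realified E).

Let scale (t : R) (x : realified E) : realified E := (t%:C%C : R[i]) *: (x : E).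

Let scaleA a b x : scale a (scale b x) = scale (a * b) x.
Proof. by rewrite /scale scalerA rmorphM. Qed.

Let scale1 x : scale 1 x = x.
Proof. by rewrite /scale rmorph1 scale1r. Qed.

Let scaleDr : right_distributive scale +%R.
Proof. by move=> a x y; rewrite /scale scalerDr. Qed.

Let scaleDl x : {morph scale^~ x : a b / a + b}.
Proof. by move=> a b; rewrite /scale rmorphD scalerDl. Qed.

HB.instance Definition _ :=
  GRing.Zmodule_isLmodule.Build R (realified E) scaleA scale1 scaleDr scaleDl.

Lemma realifiedZ (t : R) (x : realified E) : t *: x = (t%:C%C : R[i]) *: (x : E).
Proof. by []. Qed.

End Realified.

(** * Nonzero bounded functionals, and the conclusion *)

Lemma infinite_dimensional_nonzero (K : numFieldType) (E : normedModType K) :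
  infinite_dimensional [set: E] -> exists x : E, x != 0.
Proof.
move=> infE; apply: contrapT => /forallNP E0; apply: infE.
exists 0%N, (fun=> 0); apply/seteqP; split=> // x _; exists (fun=> 0) => //.
by rewrite big_ord0; apply/esym/eqP/negPn/negP/E0.
Qed.

Lemma real_bounded_functional (R : realType) (E : normedModType R) :
  infinite_dimensional [set: E] ->
  exists (f : E -> R) (x0 : E), [/\ scalar f, f x0 = 1 &
    exists2 M : R, 0 <= M & forall x, `|f x| <= M * `|x|].
Proof.
move=> /infinite_dimensional_nonzero[x x0].
have [f [linf fx fle]] := hahn_banach_seminorm (@ler_normD _ E) (@normrZ _ E) x.
have nx0 : `|x| != 0 by rewrite normr_eq0.
exists f, (`|x|^-1 *: x); split=> //; last by exists 1 => // y; rewrite mul1r.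
have f0 : f 0 = 0 by have := linf (-1) 0 0; rewrite scaler0 addr0 => ->; rewrite mulN1r addNr.
by rewrite -[_ *: x]addr0 linf f0 addr0 fx /= mulVf.
Qed.

(** Apply the real theorem to the norm on [realified E]; the real functional [u] is the real part of
    the complex-linear functional [u y - i u (i y)]. *)
Lemma complex_bounded_functional (R : realType) (E : normedModType R[i]) :
  infinite_dimensional [set: E] ->
  exists (f : E -> R[i]) (x0 : E), [/\ scalar f, f x0 = 1 &
    exists2 M : R[i], 0 <= M & forall x, `|f x| <= M * `|x|].
Proof.
move=> /infinite_dimensional_nonzero[x x0].
pose p (y : realified E) : R := complex.Re `|y : E|.
have pE y : (p y)%:C%C = `|y : E| by rewrite /p RRe_real// ger0_real.
have pD y z : p (y + z) <= p y + p z.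
  by rewrite -lecR rmorphD /= !pE ler_normD.
have pZ (t : R) y : p (t *: y) = `|t| * p y.
  apply: complexI; rewrite rmorphM /= !pE realifiedZ normrZ; congr (_ * _).
  by rewrite normc_def /= expr0n addr0 sqrtr_sqr.
have [u [linu ux ule]] := hahn_banach_seminorm pD pZ x.
have uD y z : u (y + z) = u y + u z by rewrite -[y]scale1r linu /= mul1r scale1r.
have u0 : u 0 = 0 by have := uD 0 0; rewrite addr0; lra.
have uZ (t : R) y : u (t *: y) = t * u y by rewrite -[t *: y]addr0 linu u0 addr0.
have uC (a : R[i]) (y : E) :
    u (a *: y) = complex.Re a * u y + complex.Im a * u ('i%C *: y).
  have aE : a *: y = (complex.Re a)%:C%C *: y + (complex.Im a)%:C%C *: ('i%C *: y).
    by rewrite scalerA -scalerDl {1}[a]complexE [in RHS](mulrC _ 'i%C).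
  by rewrite -!uZ -uD; exact: (congr1 u aE).
pose f (y : E) : R[i] := (u y -i* u ('i%C *: y))%C.
have linf : scalar f.
  move=> a y z; have uii : u ('i%C *: ('i%C *: y)) = - u y.
    by rewrite scalerA -expr2 sqr_i scaleN1r -[LHS]add0r -{1}(addNr (u y)) -addrA -uD subrr u0 addr0.
  have uia : u ('i%C *: (a *: y)) = complex.Re a * u ('i%C *: y) - complex.Im a * u y.
    by rewrite scalerA mulrC -scalerA uC uii mulrN.
  rewrite /f scalerDr !uD uia uC.
  by clear uia; case: a => a b; apply/eqP; rewrite eq_complex /=; apply/andP; split; apply/eqP; lra.
have f0 : f 0 = 0 by rewrite -[0](addNr 0) -scaleN1r linf mulN1r addNr.
have fZ a y : f (a *: y) = a * f y by rewrite -[a *: y]addr0 linf f0 addr0.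
have fx0 : f x != 0.
  by rewrite eq_complex /= negb_and ux -(inj_eq (@complexI _)) pE normr_eq0 x0.
exists f, ((f x)^-1 *: x); split=> //; first by rewrite fZ mulVf.
(* The constant 2 comes from bounding the real and imaginary parts of [f y] separately by the norm
   of [y]. *)
exists 2 => // y; have le_u z : `|(u z)%:C%C| <= `|z : E|.
  by rewrite normc_def /= expr0n addr0 sqrtr_sqr -pE lecR.
have -> : f y = (u y)%:C%C - 'i%C * (u ('i%C *: y))%:C%C.
  by rewrite [f y]complexE /= rmorphN mulrN.
rewrite (le_trans (ler_normB _ _))// mulrDl mul1r lerD// normrM.
rewrite (le_trans (ler_wpM2l _ (le_u _)))// normrZ.
by rewrite mulrA -normrM -expr2 sqr_i normrN normr1 mul1r.
Qed.

Theorem theorem1 (R : realType) :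
  (~ exists E : completeNormedModType R,
       indecomposable E /\ primary_factorisation_property E) /\
  (~ exists E : completeNormedModType (complex R),
       indecomposable E /\ primary_factorisation_property E).
Proof.
split=> -[E [indE pfpE]].
  have [f [x0 [linf fx0 bf]]] := real_bounded_functional indE.1.
  apply: (@indecomposable_not_primary R R idfun _ _ E f x0) => // k k0.
  by exists k.
have [f [x0 [linf fx0 bf]]] := complex_bounded_functional indE.1.
apply: (@indecomposable_not_primary R _ (real_complex R) _ _ E f x0) => //.
  by move=> r; rewrite ler0c.
move=> k k0; exists (complex.Re k); last by rewrite /= RRe_real// ger0_real.
by rewrite -ler0c RRe_real// ger0_real.
Qed.
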